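(* For every integer $n\geq 1$, $$A_{N\geq O}(n)-B_{N\geq O}(n)\equiv 0 \pmod 2,$$ and $$A_{N\geq O}(n)-B_{N\geq O}(n)\geq 0,\quad\text{with strict inequality if } n\geq 3.$$
   Context: A partition of $n$ is a finite non-increasing sequence of positive integers (its parts) with sum $n$. An overpartition of $n$ is a partition of $n$ in which the first occurrence of each number may be overlined (so for each size $t$ at most one part of size $t$ is overlined); the size of a part $t$ or $\overline{t}$ is $t$, and the weight is the sum of sizes. For an overpartition $\pi$, let $SO(\pi)$ be the size of the smallest overlined part of $\pi$ if $\pi$ has overlined parts, and $SO(\pi)=0$ otherwise. Let $\ell_{N\geq O}(\pi)$ be the number of non-overlined parts of $\pi$ (counted with multiplicity) of size greater than or equal to $SO(\pi)$. $A_{N\geq O}(n)$ (resp. $B_{N\geq O}(n)$) is the number of overpartitions $\pi$ of $n$ with $\ell_{N\geq O}(\pi)$ even (resp. odd). *)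

(* Defs.v *)
From mathcomp Require Import all_boot.

Set Implicit Arguments.
Unset Strict Implicit.
Unset Printing Implicit Defensive.

(* A part is a pair (size, overlined?); an overpartition is written as its
   sequence of parts in non-increasing order of size. The pairwise condition
   says that an overlined part has no earlier part of the same size, i.e. that
   it is the first occurrence of its size. *)
Definition is_overpartition (n : nat) (s : seq (nat * bool)) : bool :=
  [&& sorted geq [seq p.1 | p <- s],
      all (fun p => 0 < p.1) s,
      sumn [seq p.1 | p <- s] == n
    & pairwise (fun p q : nat * bool => q.2 ==> (q.1 != p.1)) s].

Definition overlined_sizes (s : seq (nat * bool)) : seq nat :=
  [seq p.1 | p <- s & p.2].

(* minn has no neutral element, so the fold starts from the first entry, which
   leaves the minimum unchanged; head gives 0 when there is no overlined part. *)
Definition SO (s : seq (nat * bool)) : nat :=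
  let o := overlined_sizes s in \big[minn/head 0 o]_(t <- o) t.

Definition ell_NgeO (s : seq (nat * bool)) : nat :=
  count (fun p => ~~ p.2 && (SO s <= p.1)) s.

(* An overpartition of n has at most n parts, each of size at most n, so the
   overpartitions of n live in a finite type of bounded sequences (see
   op_seq_inj and is_overpartition_op_seq below). *)
Definition op_code (n : nat) : finType := {bseq n of 'I_n.+1 * bool}.

Definition op_seq (n : nat) (c : op_code n) : seq (nat * bool) :=
  [seq (val p.1, p.2) | p <- (c : {bseq n of 'I_n.+1 * bool})].

Definition A_NgeO (n : nat) : nat :=
  #|[set c : op_code n
     | is_overpartition n (op_seq c) & ~~ odd (ell_NgeO (op_seq c))]|.

Definition B_NgeO (n : nat) : nat :=
  #|[set c : op_code n
     | is_overpartition n (op_seq c) & odd (ell_NgeO (op_seq c))]|.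

Lemma op_seq_inj (n : nat) : injective (@op_seq n).
Proof.
move=> c d /inj_map h; apply: val_inj; apply: h => -[i b] [j b'] /= [ij ->].
by rewrite (val_inj ij).
Qed.

Lemma is_overpartition_op_seq (n : nat) (s : seq (nat * bool)) :
  is_overpartition n s -> exists c : op_code n, op_seq c = s.
Proof.
case/and4P=> _ pos /eqP sum_s _.
have size_le : size [seq (inord p.1 : 'I_n.+1, p.2) | p <- s] <= n.
  rewrite size_map -{}sum_s; elim: s pos => //= p s IHs /andP[p_gt0 /IHs le_s].
  by rewrite -add1n leq_add.
exists (Bseq size_le); rewrite /op_seq /= -map_comp -[RHS]map_id.
apply/eq_in_map => -[t b] ps /=; rewrite inordK // ltnS -sum_s sumnE big_map.
by rewrite (big_rem _ ps) /= leq_addr.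
Qed.

(* Main.v *)
(** Reversing the overline of the head of an overpartition is an involution
    without fixed points, so the overpartitions of [n >= 1] are even in number.
    It reverses the parity of [ell_NgeO] unless no part but the head is
    overlined; in that case [ell_NgeO] is the length when the head is plain, and
    the multiplicity of the largest part minus one when it is overlined.  Hence
    [A - B] is twice the difference between the number of partitions with even
    length and odd multiplicity of the largest part, and the number of those with
    odd length and even multiplicity.  Adding the two largest parts [a, a] into
    one part [2a] injects the latter into the former, and misses the partition
    [(n/2 + 1, n - n/2 - 1)] when [n >= 3]. *)
Require Import Defs.
From mathcomp Require Import all_boot all_order all_algebra.
From mathcomp Require Import zify.

Set Implicit Arguments.
Unset Strict Implicit.
Unset Printing Implicit Defensive.

(** * Comparing counts along an injection *)

Lemma count_split (T : Type) (a b : pred T) (s : seq T) :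
  count a s = count (predI a b) s + count (predI a (predC b)) s.
Proof. by elim: s => //= x s ->; case: (a x); case: (b x) => /=; lia. Qed.

Lemma leq_count_inj (T : eqType) (f : T -> T) (a b : pred T) (s : seq T) :
  uniq s -> {in [pred x | (x \in s) && a x] &, injective f} ->
  {in s, forall x, a x -> (f x \in s) && b (f x)} ->
  count a s <= count b s.
Proof.
move=> us finj fab; rewrite -!size_filter -(size_map f).
apply: uniq_leq_size => [|_ /mapP[x + ->]].
  rewrite map_inj_in_uniq ?filter_uniq // => x y.
  rewrite !mem_filter => /andP[ax xs] /andP[ay ys].
  by apply: finj; rewrite inE ?xs ?ys.
by rewrite !mem_filter => /andP[ax xs]; rewrite andbC fab.
Qed.

Lemma ltn_count_inj (T : eqType) (f : T -> T) (a b : pred T) (s : seq T) w :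
  uniq s -> {in [pred x | (x \in s) && a x] &, injective f} ->
  {in s, forall x, a x -> (f x \in s) && b (f x)} ->
  w \in s -> b w -> {in s, forall x, a x -> f x != w} ->
  count a s < count b s.
Proof.
move=> us finj fab ws bw wf.
have <- : (count (predI b (predC1 w)) s).+1 = count b s.
  rewrite (count_split b (pred1 w)) -add1n; congr (_ + _).
  transitivity (count_mem w s); first by rewrite count_uniq_mem ?ws.
  by apply: eq_count => x /=; case: eqP => [->|]; rewrite ?bw ?andbF.
rewrite ltnS; apply: (leq_count_inj (f := f)) => // x xs ax.
by case/andP: (fab x xs ax) => -> /= ->; rewrite wf.
Qed.

(** * The list of overpartitions and the reversal of the head's overline *)

Definition overpartitions (n : nat) : seq (seq (nat * bool)) :=
  [seq s <- [seq op_seq c | c <- enum (op_code n)] | is_overpartition n s].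

Lemma mem_overpartitions n s : (s \in overpartitions n) = is_overpartition n s.
Proof.
rewrite mem_filter; case h: is_overpartition => //=.
by have [c <-] := is_overpartition_op_seq h; rewrite map_f // mem_enum.
Qed.

Lemma uniq_overpartitions n : uniq (overpartitions n).
Proof. by rewrite filter_uniq // map_inj_uniq ?enum_uniq //; apply: op_seq_inj. Qed.

Lemma card_overpartitions n (a : pred (seq (nat * bool))) :
  #|[set c : op_code n | is_overpartition n (op_seq c) & a (op_seq c)]|
  = count a (overpartitions n).
Proof.
rewrite cardsE cardE /enum_mem size_filter -enumT /overpartitions count_filter count_map.
by apply: eq_count => c; rewrite /= andbC.
Qed.

Definition toggle (s : seq (nat * bool)) :=
  if s is p :: r then (p.1, ~~ p.2) :: r else [::].

Lemma toggleK : involutive toggle.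
Proof. by case=> [|[a b] r] //=; rewrite negbK. Qed.

Lemma is_overpartition_toggle n s :
  is_overpartition n (toggle s) = is_overpartition n s.
Proof. by case: s. Qed.

Lemma count_toggle n (a : pred (seq (nat * bool))) :
  count (preim toggle a) (overpartitions n) = count a (overpartitions n).
Proof.
rewrite -count_map; apply/permP/uniq_perm; rewrite ?uniq_overpartitions //.
  by rewrite (map_inj_uniq (inv_inj toggleK)) uniq_overpartitions.
move=> s; rewrite -{1}(toggleK s) (mem_map (inv_inj toggleK)).
by rewrite !mem_overpartitions is_overpartition_toggle.
Qed.

Lemma even_size_overpartitions n : 0 < n -> ~~ odd (size (overpartitions n)).
Proof.
move=> n_gt0; pose h (s : seq (nat * bool)) := if s is p :: _ then p.2 else false.
(* As [n > 0], every member has a head, so [toggle] exchanges those with an overlined head and those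
   with a plain one. *)
rewrite -(count_predC h) -(count_toggle _ h).
rewrite (@eq_in_count _ _ (predC h)) ?addnn ?odd_double // => -[|[a b] r] //=.
by rewrite mem_overpartitions /is_overpartition /=; case: n n_gt0.
Qed.

(** * The effect of a largest part on [SO] and [ell_NgeO] *)

Lemma is_overpartition_cons n a b r :
  is_overpartition n ((a, b) :: r) ->
  [/\ 0 < a, all (fun p => p.1 <= a) r & n = a + sumn [seq p.1 | p <- r]].
Proof.
case/and4P=> /= + /andP[-> _] /eqP<- _.
rewrite path_sortedE; last by move=> x y z /= yx xz; apply: leq_trans yx.
by rewrite all_map => /andP[le_a _].
Qed.

Lemma SO_cons_plain a b r :
  ~~ has (fun p => p.2) r -> SO ((a, b) :: r) = if b then a else 0.
Proof.
rewrite has_filter negbK => /eqP r0.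
rewrite /SO /overlined_sizes /=; case: b; rewrite /= r0 ?big_nil //=.
by rewrite big_cons big_nil minnn.
Qed.

(** The fold in [SO] starts from the first overlined size, which changes when an overlined [a >= p]
    is put in front of [p]. Once [p] is itself an entry, both starts give the same minimum. *)
Lemma minn_big_idx a p (q : seq nat) :
  p <= a -> minn p (\big[minn/a]_(t <- q) t) = minn p (\big[minn/p]_(t <- q) t).
Proof.
move=> pa; elim: q => [|x q IHq]; first by rewrite !big_nil minnn; apply/minn_idPl.
by rewrite !big_cons minnCA IHq minnCA.
Qed.

Lemma SO_cons_overlined a b r :
  has (fun p => p.2) r -> all (fun p => p.1 <= a) r ->
  SO ((a, b) :: r) = SO r /\ SO r <= a.
Proof.
rewrite has_filter => r0 le_a.
have : all (fun t => t <= a) (overlined_sizes r).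
  by rewrite all_map all_filter; apply: sub_all le_a => p /= ->; rewrite implybT.
rewrite /SO (_ : overlined_sizes ((a, b) :: r) =
  if b then a :: overlined_sizes r else overlined_sizes r); last by case: b.
have: overlined_sizes r != [::] by rewrite -size_eq0 size_map size_eq0.
case: (overlined_sizes r) => //= p q _ /andP[pa _].
have le_big : \big[minn/p]_(t <- p :: q) t <= a.
  by rewrite big_cons geq_min pa.
split=> //; case: b => //=; rewrite big_cons -[RHS](minn_idPr le_big).
by congr minn; rewrite !big_cons minn_big_idx.
Qed.

Lemma ell_cons_overlined a b r :
  has (fun p => p.2) r -> all (fun p => p.1 <= a) r ->
  ell_NgeO ((a, b) :: r) = ~~ b + ell_NgeO r.
Proof.
move=> r0 ra; rewrite /ell_NgeO /=.
by case: (SO_cons_overlined b r0 ra) => -> ->; rewrite andbT.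
Qed.

(** An overlined head gives [SO = a], so only plain parts of the maximal size count; a plain head
    gives [SO = 0], so every part counts. *)
Lemma ell_cons_plain a b r :
  ~~ has (fun p => p.2) r -> all (fun p => p.1 <= a) r ->
  ell_NgeO ((a, b) :: r) =
  if b then count (fun p => p.1 == a) r else (size r).+1.
Proof.
move=> r0 /allP ra; rewrite /ell_NgeO /= SO_cons_plain //.
have plain p : p \in r -> ~~ p.2 by move/hasPn: r0; apply.
case: b => /=.
  by apply: eq_in_count => p pr; rewrite plain // eqn_leq ra.
by rewrite add1n -count_predT; congr _.+1; apply: eq_in_count => p /plain->.
Qed.

(** * Parity of [ell_NgeO] under [toggle] *)

Definition odd_ell s := odd (ell_NgeO s).

(* The overpartitions for which [toggle] does not change the parity of
   [ell_NgeO]; [e] tells whether that parity is even. *)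
Definition stuck (s : seq (nat * bool)) (e : bool) :=
  if s is (a, _) :: r then
    [&& ~~ has (fun p => p.2) r, odd (size r) == e
      & odd (count (fun p => p.1 == a) r) == ~~ e]
  else false.

(** With an overlined part in the tail, [toggle] changes [ell_NgeO] by one and both sides are false.
    Otherwise the two parities are those of [(size r).+1] and of the number of parts of size [a] in
    [r], in an order set by [b]. *)
Lemma odd_ell_toggle n s e : 0 < n -> is_overpartition n s ->
  ((odd_ell s == ~~ e) && (odd_ell (toggle s) == ~~ e)) = stuck s e.
Proof.
case: s => [|[a b] r]; first by case: n.
move=> _ /is_overpartition_cons[_ ra _]; rewrite /odd_ell /=.
have [r0|r0] := boolP (has _ r).
  rewrite !ell_cons_overlined // !oddD.
  by case: b; case: e => /=; case: odd.
rewrite !ell_cons_plain //.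
by case: b => /=; case: e; do 2!case: odd.
Qed.

(** * Merging the two largest parts *)

Definition merge2 (s : seq (nat * bool)) :=
  if s is (a, b) :: (x, _) :: r then (a + x, b) :: r else [::].

Lemma stuck_false n s : is_overpartition n s -> stuck s false ->
  exists a b r, [/\ s = [:: (a, b), (a, false) & r],
    ~~ has (fun p => p.2) r, all (fun p => p.1 <= a) r,
    odd (size r) & ~~ odd (count (fun p => p.1 == a) r)].
Proof.
case: s => [|[a b] [|[x c] r]] //= /[dup] /is_overpartition_cons[_ /= + _].
case/andP=> xa _ /and4P[/= /andP[_]].
rewrite path_sortedE; last by move=> u v w /= vu uw; apply: leq_trans vu.
rewrite all_map negb_or => /andP[rx _] _ _ _ /and3P[/andP[/negbTE-> r0] /eqP/negbFE sr].
(* A second part smaller than [a] would leave no part of size [a] in the tail, but their number is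
   odd. *)
move=> cr; have xa_eq : x = a.
  apply/eqP; rewrite eqn_leq xa leqNgt; apply/negP => lt_xa; move: cr.
  rewrite (ltn_eqF lt_xa) (@eq_in_count _ _ pred0) ?count_pred0 // => p pr /=.
  by apply/ltn_eqF/leq_ltn_trans/lt_xa/(allP rx).
rewrite xa_eq in rx cr *; exists a, b, r; split=> //.
by move: cr; rewrite eqxx add1n /=; case: odd.
Qed.

Lemma is_overpartition_merge2 n s :
  is_overpartition n s -> stuck s false ->
  is_overpartition n (merge2 s) && stuck (merge2 s) true.
Proof.
move=> ops st; have [a [b [r [es r0 ra sr cr]]]] := stuck_false ops st.
rewrite {}es {st} in ops *; have [a_gt0 _ ->] := is_overpartition_cons ops.
move: ops; rewrite /is_overpartition /= => /and4P[].
rewrite r0 sr !addnA eqxx => /andP[_] rsort /and3P[_ _ r_gt0] _ /and3P[_ _ rpw].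
rewrite addn_gt0 a_gt0 r_gt0 rpw /= andbT.
(* The merged part exceeds all others, so it keeps its overline legally and its size does not recur
   in the tail. *)
have ltr p : p \in r -> p.1 < a + a.
  by move/(allP ra) => /leq_ltn_trans; apply; rewrite -addn1 leq_add2l.
rewrite -andbA; apply/and3P; split.
- move: rsort; rewrite !path_sortedE => [/andP[_ ->]||];
    try by move=> x y z /= yx xz; apply: leq_trans yx.
  by rewrite andbT all_map; apply/allP => p /ltr /ltnW.
- by apply/allP => p pr /=; apply/implyP => _; rewrite ltn_eqF ?ltr.
- rewrite (@eq_in_count _ _ pred0) ?count_pred0 // => p pr /=.
  by rewrite ltn_eqF ?ltr.
Qed.

Lemma merge2_inj n :
  {in [pred s | is_overpartition n s && stuck s false] &, injective merge2}.
Proof.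
move=> s t /andP[ops ss] /andP[opt st].
have [a [b [r [-> _ _ _ _]]]] := stuck_false ops ss.
have [a' [b' [r' [-> _ _ _ _]]]] := stuck_false opt st.
by case=> aa -> ->; have -> : a = a' by lia.
Qed.

Definition missed (n : nat) : seq (nat * bool) :=
  [:: (n./2.+1, false); ((uphalf n).-1, false)].

Lemma is_overpartition_missed n :
  2 < n -> is_overpartition n (missed n) && stuck (missed n) true.
Proof.
move=> n_gt2; have := odd_double_half n; have := uphalf_half n => eu en.
by rewrite /is_overpartition /= !andbT addn0; apply/andP; split; lia.
Qed.

(** Here [r] would be the single part [(uphalf n).-1], at most [a] and, by the even count, not equal
    to [a]. With [a + a = n./2.+1] this forces [a = 1] and [n <= 2]. *)
Lemma merge2_missed n s :
  2 < n -> is_overpartition n s -> stuck s false -> merge2 s != missed n.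
Proof.
move=> n_gt2 ops st; have [a [b [r [-> _ ra _ cr]]]] := stuck_false ops st.
apply/eqP => -[aa _ er]; move: ra cr; rewrite er /= andbT addn0.
have := odd_double_half n; have := uphalf_half n.
lia.
Qed.

Theorem theorem2p5 (n : nat) (hn : (1 <= n)%N) :
  ((A_NgeO n)%:Z - (B_NgeO n)%:Z = 0 %[mod 2])%Z /\
  (0 <= (A_NgeO n)%:Z - (B_NgeO n)%:Z)%R /\
  ((3 <= n)%N -> (0 < (A_NgeO n)%:Z - (B_NgeO n)%:Z)%R).
Proof.
pose L := overpartitions n; pose o' := preim toggle odd_ell.
have eA : A_NgeO n = count (predC odd_ell) L by rewrite -card_overpartitions.
have eB : B_NgeO n = count odd_ell L by rewrite -card_overpartitions.
have inL s : s \in L -> is_overpartition n s by rewrite mem_overpartitions.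
have evenAB : ~~ odd (B_NgeO n + A_NgeO n).
  by rewrite eA eB count_predC even_size_overpartitions.
(* [toggle] exchanges the overpartitions whose parity goes from odd to even with those going from
   even to odd, so these cancel in the difference. *)
have toggleAB : count (predI odd_ell (predC o')) L
              = count (predI (predC odd_ell) o') L.
  rewrite -count_toggle; apply: eq_count => s /=.
  by rewrite toggleK andbC.
have eB2 : B_NgeO n =
  count (predI odd_ell (predC o')) L + count (stuck^~ false) L.
  rewrite eB (count_split _ o') addnC; congr (_ + _).
  apply: eq_in_count => s /inL ops.
  by rewrite -(odd_ell_toggle _ hn ops) !eqb_id.
have eA2 : A_NgeO n =
  count (predI odd_ell (predC o')) L + count (stuck^~ true) L.
  rewrite eA (count_split _ o') toggleAB; congr (_ + _).
  apply: eq_in_count => s /inL ops.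
  by rewrite -(odd_ell_toggle _ hn ops) !eqbF_neg.
have mergeL : {in L, forall s,
  stuck s false -> (merge2 s \in L) && stuck (merge2 s) true}.
  by move=> s /inL ops; rewrite mem_overpartitions; apply: is_overpartition_merge2.
have injL : {in [pred s | (s \in L) && stuck s false] &, injective merge2}.
  by move=> s t; rewrite !inE !mem_overpartitions; apply: merge2_inj.
have uL : uniq L := uniq_overpartitions n.
have leBA : B_NgeO n <= A_NgeO n.
  by rewrite eA2 eB2 leq_add2l (leq_count_inj uL injL mergeL).
have ltBA : 2 < n -> B_NgeO n < A_NgeO n.
  move=> n_gt2; have /andP[opw stw] := is_overpartition_missed n_gt2.
  rewrite eA2 eB2 ltn_add2l (ltn_count_inj uL injL mergeL _ stw) //.
    by rewrite mem_overpartitions.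
  by move=> s /inL ops; apply: merge2_missed.
(* The difference has the parity of the sum, which is even by [evenAB]. *)
split; first by lia.
by split=> [|/ltBA]; lia.
Qed.
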